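(* Let $(\cdot,\cdot)^h:S\times S\to(Q\times Q)/G$ be a splitting of the discrete Atiyah sequence, i.e. $(\pi,\pi)\circ(\cdot,\cdot)^h=1_{S\times S}$. For $(x_0,x_1)\in S\times S$ and $q_0\in\pi^{-1}(x_0)$, let $(x_0,x_1)^h_{q_0}$ be the unique element of $(x_0,x_1)^h$, regarded as a subset ($G$-orbit) of $Q\times Q$, whose first component is $q_0$. Then this defines a discrete horizontal lift with the requisite properties: $(x_0,x_1)^h_{gq_0}=g\cdot(x_0,x_1)^h_{q_0}$ for all $g\in G$, and $(\pi,\pi)\big((x_0,x_1)^h_{q_0}\big)=(x_0,x_1)$.
   Context: $Q$ is a smooth manifold with a free smooth left action $(g,q)\mapsto gq$ of a Lie group $G$ such that the projection $\pi:Q\to S=Q/G$ is a submersion. $G$ acts on $Q\times Q$ diagonally, $g\cdot(q_0,q_1)=(gq_0,gq_1)$, and $(\pi,\pi)(q_0,q_1)=(\pi q_0,\pi q_1)$, which descends to $(Q\times Q)/G$. The discrete Atiyah sequence is $0\to\tilde{G}\xrightarrow{\,i\,}(Q\times Q)/G\xrightarrow{(\pi,\pi)}S\times S\to0$, where $\tilde{G}=(Q\times G)/G$ for the action $k(q,g)=(kq,kgk^{-1})$ and $i([q,g]_G)=[q,gq]_G$. *)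

(* Defs.v *)
From HB Require Import structures.
From mathcomp Require Import all_boot all_order all_algebra.
From mathcomp Require Import all_classical all_reals all_analysis.
Import numFieldNormedType.Exports.

Set Implicit Arguments.
Unset Strict Implicit.
Unset Printing Implicit Defensive.

Local Open Scope classical_set_scope.
Local Open Scope quotient_scope.

Section SmoothManifolds.
Context {R : realType}.

(* E is meant to be finite dimensional: only then do C^k directional
   derivatives characterize C^(k+1) maps. U is meant to be open. *)
Fixpoint Ck (k : nat) {E F : normedModType R} (U : set E) (f : E -> F) : Prop :=
  if k is k'.+1 then
    (forall x, U x -> differentiable f x) /\
    (forall v, Ck k' U (fun x => 'D_v f x))
  else forall x, U x -> {for x, continuous f}.

Definition smooth_on {E F : normedModType R} (U : set E) (f : E -> F) :=
  forall k, Ck k U f.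

(* The inverse chart_bwd is only relevant on the image of chart_dom, and
   chart_fwd only on chart_dom. *)
Record chart (M E : Type) := Chart {
  chart_dom : set M;
  chart_fwd : M -> E;
  chart_bwd : E -> M
}.

Definition chart_img {M E : Type} (c : chart M E) : set E :=
  chart_fwd c @` chart_dom c.

Definition is_chart {M : topologicalType} {E : normedModType R}
    (c : chart M E) :=
  [/\ open (chart_dom c),
      open (chart_img c),
      forall x, chart_dom c x -> chart_bwd c (chart_fwd c x) = x,
      forall x, chart_dom c x -> {for x, continuous (chart_fwd c)} &
      forall y, chart_img c y -> {for y, continuous (chart_bwd c)}].

Definition compatible {M : Type} {E : normedModType R} (c d : chart M E) :=
  smooth_on (chart_fwd c @` (chart_dom c `&` chart_dom d))
            (chart_fwd d \o chart_bwd c).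

Definition smooth_atlas {M : topologicalType} {E : normedModType R}
    (A : set (chart M E)) :=
  [/\ forall c, A c -> is_chart c,
      forall x, exists2 c, A c & chart_dom c x &
      forall c d, A c -> A d -> compatible c d].

(* The atlas need not be maximal: smoothness of maps depends only on the
   maximal atlas that it generates. *)
Definition smooth_manifold {M : topologicalType} {n : nat}
    (A : set (chart M 'rV[R]_n)) :=
  [/\ hausdorff_space M, second_countable (T := M) & smooth_atlas A].

Definition prod_chart {M N E F : Type} (c : chart M E) (d : chart N F) :
    chart (M * N)%type (E * F)%type :=
  Chart (chart_dom c `*` chart_dom d)
        (fun p => (chart_fwd c p.1, chart_fwd d p.2))
        (fun p => (chart_bwd c p.1, chart_bwd d p.2)).

Definition prod_atlas {M N E F : Type}
    (A : set (chart M E)) (B : set (chart N F)) :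
    set (chart (M * N)%type (E * F)%type) :=
  [set e | exists c d, [/\ A c, B d & e = prod_chart c d]].

Definition local_map {M N E F : Type} (c : chart M E) (d : chart N F)
    (f : M -> N) : E -> F :=
  chart_fwd d \o f \o chart_bwd c.

Definition smooth_map {M N : topologicalType} {E F : normedModType R}
    (A : set (chart M E)) (B : set (chart N F)) (f : M -> N) :=
  continuous f /\
  forall c d, A c -> B d ->
    smooth_on (chart_fwd c @` (chart_dom c `&` f @^-1` chart_dom d))
              (local_map c d f).

Definition submersion {M N : topologicalType} {E F : normedModType R}
    (A : set (chart M E)) (B : set (chart N F)) (f : M -> N) :=
  smooth_map A B f /\
  forall c d x, A c -> B d -> chart_dom c x -> chart_dom d (f x) ->
    range ('d (local_map c d f) (chart_fwd c x)) = [set: F].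

End SmoothManifolds.

(* A type with both a group law and a topology; the continuity of the group
   operations is part of lie_group. *)
#[short(type="topGroupType")]
HB.structure Definition TopGroup := {G of Group G & Topological G}.

Definition lie_group {R : realType} {G : topGroupType} {n : nat}
    (A : set (chart G 'rV[R]_n)) :=
  [/\ smooth_manifold A,
      smooth_map (prod_atlas A A) A (fun p : G * G => (p.1 * p.2)%g) &
      smooth_map A A (fun g : G => (g^-1)%g)].

Record left_action (G : groupType) (X : Type) := LeftAction {
  act :> G -> X -> X;
  act1 : forall x, act 1%g x = x;
  actM : forall g h x, act (g * h)%g x = act g (act h x)
}.

Definition free_action {G : groupType} {X : Type} (a : left_action G X) :=
  forall g x, a g x = x -> g = 1%g.

Definition smooth_action {R : realType} {G : topGroupType}
    {Q : topologicalType} {m n : nat}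
    (AG : set (chart G 'rV[R]_m)) (AQ : set (chart Q 'rV[R]_n))
    (a : left_action G Q) :=
  smooth_map (prod_atlas AG AQ) AQ (fun p : G * Q => a p.1 p.2).

Section OrbitSpace.
Context {G : groupType} {X : topologicalType} (a : left_action G X).

Definition same_orbit : rel X := fun x y => `[< exists g, y = a g x >].

Lemma same_orbit_refl : reflexive same_orbit.
Proof. by move=> x; apply/asboolP; exists 1%g; rewrite act1. Qed.

Lemma same_orbit_sym : symmetric same_orbit.
Proof.
suff H x y : same_orbit x y -> same_orbit y x.
  by move=> x y; apply/idP/idP; apply: H.
move=> /asboolP[g ->]; apply/asboolP; exists (g^-1)%g.
by rewrite -actM mulVg act1.
Qed.

Lemma same_orbit_trans : transitive same_orbit.
Proof.
move=> y x z /asboolP[g ->] /asboolP[h ->]; apply/asboolP.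
by exists (h * g)%g; rewrite actM.
Qed.

Canonical same_orbit_equiv :=
  EquivRel same_orbit same_orbit_refl same_orbit_sym same_orbit_trans.

Definition orbit_space : topologicalType :=
  quotient_topology {eq_quot same_orbit}.

Definition orbit_proj (x : X) : orbit_space := \pi_({eq_quot same_orbit}) x.

Definition orbit_repr (O : orbit_space) : X :=
  repr (O : {eq_quot same_orbit}).

Lemma orbit_reprK : cancel orbit_repr orbit_proj.
Proof. exact: reprK. Qed.

Lemma orbit_projE x y : orbit_proj x = orbit_proj y <-> exists g, y = a g x.
Proof.
rewrite /orbit_proj; split => [/eqmodP/asboolP //|H].
by apply/eqmodP/asboolP.
Qed.

Definition orbit_set (O : orbit_space) : set X := [set x | orbit_proj x = O].

End OrbitSpace.

Section DiscreteAtiyah.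
Context {G : groupType} {Q : topologicalType} (a : left_action G Q).

Definition diag_fun (g : G) (p : Q * Q) : Q * Q := (a g p.1, a g p.2).

Lemma diag_fun1 p : diag_fun 1%g p = p.
Proof. by case: p => x y; rewrite /diag_fun !act1. Qed.

Lemma diag_funM g h p : diag_fun (g * h)%g p = diag_fun g (diag_fun h p).
Proof. by rewrite /diag_fun !actM. Qed.

Definition diag_action : left_action G (Q * Q)%type :=
  LeftAction diag_fun1 diag_funM.

Definition proj_pair (p : Q * Q) : orbit_space a * orbit_space a :=
  (orbit_proj a p.1, orbit_proj a p.2).

Definition atiyah_proj (O : orbit_space diag_action) :
    orbit_space a * orbit_space a :=
  proj_pair (orbit_repr O).

Lemma atiyah_projE (p : Q * Q) :
  atiyah_proj (orbit_proj diag_action p) = proj_pair p.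
Proof.
rewrite /atiyah_proj /proj_pair.
have /orbit_projE[g eg] := orbit_reprK (orbit_proj diag_action p).
congr (_, _); apply/orbit_projE; exists g.
  exact: (congr1 fst eg).
exact: (congr1 snd eg).
Qed.

Definition atiyah_splitting
    (h : orbit_space a * orbit_space a -> orbit_space diag_action) :=
  forall x, atiyah_proj (h x) = x.

Definition lift_candidates
    (h : orbit_space a * orbit_space a -> orbit_space diag_action)
    (x : orbit_space a * orbit_space a) (q0 : Q) : set (Q * Q) :=
  [set p | orbit_set (h x) p /\ p.1 = q0].

(* Only meaningful for q0 in the fibre over x.1; the default value (q0, q0) is
   irrelevant there. *)
Definition hlift
    (h : orbit_space a * orbit_space a -> orbit_space diag_action)
    (x : orbit_space a * orbit_space a) (q0 : Q) : Q * Q :=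
  xget (q0, q0) (lift_candidates h x q0).

(* L x q0 is constrained only for q0 in the fibre over x.1. *)
Definition discrete_horizontal_lift
    (L : orbit_space a * orbit_space a -> Q -> Q * Q) :=
  forall x q0, orbit_proj a q0 = x.1 ->
    (forall g, L x (a g q0) = diag_action g (L x q0)) /\
    proj_pair (L x q0) = x.

End DiscreteAtiyah.

(* Main.v *)
(* An element (q, q') of the orbit h(x) has q in the fibre over x.1, so if q0
   lies in the same fibre then q0 = g q and (q0, g q') is again in the orbit.
   Two elements of the orbit with the same first component differ by a group
   element fixing that component, which is 1 because the action is free.
   Equivariance follows from uniqueness. *)

Require Import Defs.
From mathcomp Require Import all_boot all_order all_algebra.
From mathcomp Require Import all_classical all_reals all_analysis.
Import numFieldNormedType.Exports.

Lemma orbit_set_act (G : groupType) (X : topologicalType) (a : left_action G X)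
  (O : orbit_space a) (g : G) (x : X) : orbit_set O x -> orbit_set O (a g x).
Proof.
move=> <-; rewrite /orbit_set /=.
by apply/esym/orbit_projE; exists g.
Qed.

Section HorizontalLift.
Context {G : groupType} {Q : topologicalType} (a : left_action G Q).
Context (h : orbit_space a * orbit_space a -> orbit_space (diag_action a)).

(** Serves twice: it moves a representative of the orbit over a prescribed [q0], and it gives the
    equivariance of the lift. *)
Lemma lift_candidates_act x q0 g p :
  lift_candidates h x q0 p ->
  lift_candidates h x (a g q0) (diag_action a g p).
Proof. by case=> hp <-; split=> //; exact: orbit_set_act. Qed.

Lemma lift_candidates_inj x q0 p p' : free_action a ->
  lift_candidates h x q0 p -> lift_candidates h x q0 p' -> p = p'.
Proof.
move=> a_free [hp p1] [hp' p1'].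
have /orbit_projE[g p'E] : orbit_proj (diag_action a) p =
    orbit_proj (diag_action a) p' by rewrite hp hp'.
have g1 : g = 1%g.
  by apply: (a_free g p.1); rewrite [RHS]p1 -p1' p'E.
by rewrite p'E g1 act1.
Qed.

Context (h_splitting : atiyah_splitting h).

(** [atiyah_proj] can be computed at any point of the orbit, so the splitting identity applies to
    [p] itself. *)
Lemma proj_pair_orbit_set x p : orbit_set (h x) p -> proj_pair a p = x.
Proof. by move=> hp; rewrite -atiyah_projE hp h_splitting. Qed.

(** Over the right fibre a candidate exists, so [xget] never falls back on its default
    [(q0, q0)]. *)
Lemma hlift_candidate x q0 : orbit_proj a q0 = x.1 ->
  lift_candidates h x q0 (hlift h x q0).
Proof.
move=> q0x; set p := orbit_repr (h x).
have hp : orbit_set (h x) p by exact: orbit_reprK.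
(* The splitting puts [p.1] in the fibre over [x.1], hence some [g] carries it to [q0]. *)
have /orbit_projE[g q0E] : orbit_proj a p.1 = orbit_proj a q0.
  by rewrite q0x -(proj_pair_orbit_set x p hp).
apply: (xgetI _ (x := diag_action a g p)).
by rewrite q0E; exact: lift_candidates_act.
Qed.

End HorizontalLift.

Theorem lemma4p12 (R : realType) (G : topGroupType) (Q : topologicalType)
  (nG nQ nS : nat)
  (a : left_action G Q)
  (AG : set (chart G 'rV[R]_nG))
  (AQ : set (chart Q 'rV[R]_nQ))
  (AS : set (chart (orbit_space a) 'rV[R]_nS))
  (G_lie : lie_group AG)
  (Q_manifold : smooth_manifold AQ)
  (S_manifold : smooth_manifold AS)
  (a_smooth : smooth_action AG AQ a)
  (a_free : free_action a)
  (pi_submersion : submersion AQ AS (orbit_proj a))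
  (h : orbit_space a * orbit_space a -> orbit_space (diag_action a))
  (h_splitting : atiyah_splitting h) :
  (forall (x0 x1 : orbit_space a) (q0 : Q), orbit_proj a q0 = x0 ->
     unique (fun p : Q * Q => orbit_set (h (x0, x1)) p /\ p.1 = q0)
            (hlift h (x0, x1) q0)) /\
  discrete_horizontal_lift (hlift h).
Proof.
split=> [x0 x1 q0 q0x|x q0 q0x].
  have lq0 := hlift_candidate a h h_splitting (x0, x1) q0 q0x.
  by split=> // p; exact: lift_candidates_inj.
have lq0 := hlift_candidate a h h_splitting x q0 q0x.
split=> [g|]; last by case: lq0 => + _; exact: proj_pair_orbit_set.
(* Both sides are candidates over [a g q0], which stays in the fibre of [q0]. *)
apply: (lift_candidates_inj a h x (a g q0)) => //.
  apply: hlift_candidate => //; rewrite -q0x.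
  by apply/esym/orbit_projE; exists g.
exact: lift_candidates_act.
Qed.
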